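(* For every integer $k\ge 1$, the cycle $C_{4k}$ admits a $4$-graceful $\alpha$-labeling.
   Context: $C_n$ denotes the cycle on $n$ vertices (with $n$ edges). For a graph $\Gamma$ of size $e$ and a divisor $d$ of $e$ with $e=d\cdot m$, a $d$-graceful labeling of $\Gamma$ is an injective function $f:V(\Gamma)\to\{0,1,\ldots,d(m+1)-1\}$ such that $\{|f(x)-f(y)| : [x,y]\in E(\Gamma)\}=\{1,2,\ldots,d(m+1)-1\}\setminus\{m+1,2(m+1),\ldots,(d-1)(m+1)\}$. If $\Gamma$ is bipartite with parts $X,Y$, a $d$-graceful $\alpha$-labeling is a $d$-graceful labeling $f$ such that $\max f(X)<\min f(Y)$ for a suitable ordering of the two parts. *)

(* Defs.v *)
From mathcomp Require Import all_boot all_order all_algebra.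
Set Implicit Arguments.
Unset Strict Implicit.
Unset Printing Implicit Defensive.

Record sgraph := SGraph {
  vertex :> finType;
  adj : rel vertex;
  adj_sym : symmetric adj;
  adj_irrefl : irreflexive adj
}.

Definition edges (G : sgraph) : {set {set G}} :=
  [set [set p.1; p.2] | p : G * G & adj p.1 p.2].

Definition graph_size (G : sgraph) : nat := #|edges G|.

(* The test [i != j] only matters for n = 1, where it rules out a loop; this
   is the n-cycle when n >= 3. *)
Definition cycle_adj (n : nat) : rel 'I_n :=
  fun i j => (i != j) && ((j == i.+1 %% n :> nat) || (i == j.+1 %% n :> nat)).

Lemma cycle_adj_sym n : symmetric (@cycle_adj n).
Proof. by move=> i j; rewrite /cycle_adj eq_sym orbC. Qed.

Lemma cycle_adj_irrefl n : irreflexive (@cycle_adj n).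
Proof. by move=> i; rewrite /cycle_adj eqxx. Qed.

Definition cycle_graph (n : nat) : sgraph :=
  SGraph (@cycle_adj_sym n) (@cycle_adj_irrefl n).

Definition graceful_labeling (d : nat) (G : sgraph) (f : G -> nat) : Prop :=
  exists m : nat,
    [/\ 0 < d,
        graph_size G = d * m,
        injective f,
        forall x : G, f x <= d * (m + 1) - 1
      & forall n : nat,
          (exists x y : G, adj x y /\ n = `|f x - f y|%N)
          <->
          (1 <= n <= d * (m + 1) - 1
           /\ ~ (exists i : nat, 1 <= i <= d - 1 /\ n = i * (m + 1)))].

Definition bipartition (G : sgraph) (X Y : {set G}) : Prop :=
  [/\ X :|: Y = [set: G],
      [disjoint X & Y]
    & forall x y : G, adj x y ->
        (x \in X) && (y \in Y) || (x \in Y) && (y \in X)].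

Definition graceful_alpha_labeling (d : nat) (G : sgraph) (f : G -> nat) :
    Prop :=
  graceful_labeling d f /\
  exists X Y : {set G},
    bipartition X Y /\
    forall x y : G, x \in X -> y \in Y -> f x < f y.

(* Main.v *)
Require Import Defs.
From mathcomp Require Import all_boot all_order all_algebra.
From mathcomp Require Import zify.
Set Implicit Arguments.
Unset Strict Implicit.
Unset Printing Implicit Defensive.

(** Go around the cycle from vertex 0 (labelled 0), alternating between low
    labels that increase and high labels that decrease, so that the edge
    differences decrease from 4k+3 to 1, skipping the forbidden multiples of
    k+1 and also 2k+1.  The last label is the alternating sum of these
    differences, namely 2k plus the number of values skipped at a low-label
    step.  The values 2k+1 and 2k+2 are skipped together at a high-label step,
    and, whatever the parity of k, exactly one of k+1 and 3k+3 is skipped at a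
    low-label step.  Hence the last label is 2k+1, and the closing edge supplies
    the missing difference. *)

Lemma cycle_adjE n (i j : 'I_n) : 1 < n ->
  cycle_adj i j = [|| j == i.+1 :> nat, i == j.+1 :> nat,
                      (i == n.-1 :> nat) && (j == 0 :> nat)
                    | (j == n.-1 :> nat) && (i == 0 :> nat)].
Proof.
move=> n_gt1; rewrite /cycle_adj -val_eqE /=.
have modS (a : 'I_n) : a.+1 %% n = if a == n.-1 :> nat then 0 else a.+1.
  have lt_an := ltn_ord a.
  case: eqP => [->|ne]; last by rewrite modn_small //; lia.
  by rewrite prednK ?modnn //; lia.
rewrite !modS; have := ltn_ord i; have := ltn_ord j.
by case: ifP; case: ifP; lia.
Qed.

(** Sending each vertex to the edge towards its successor is onto the edges. It is injective only
    for n > 2: for n = 2 both vertices yield the same edge. *)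
Lemma cycle_graph_size n : 2 < n -> graph_size (cycle_graph n) = n.
Proof.
case: n => // n n_gt2; pose e (i : 'I_n.+1) := [set i; ordS i].
have ordSE (i : 'I_n.+1) : ordS i = (if i == n :> nat then 0 else i.+1) :> nat.
  have lt_in := ltn_ord i; case: eqP => [/= ->|ne /=]; first by rewrite modnn.
  by rewrite modn_small //; lia.
rewrite /graph_size; have -> : edges (cycle_graph n.+1) = e @: [set: 'I_n.+1].
  apply/setP => A; apply/imsetP/imsetP => [[[i j]]|[i _ ->]].
    rewrite inE /= /cycle_adj => /andP[_ /orP[/eqP ji|/eqP ij]] ->.
      by exists i; rewrite ?inE // /e; congr [set _; _]; apply: val_inj.
    by exists j; rewrite ?inE // /e setUC; congr [set _; _]; apply: val_inj.
  exists (i, ordS i); rewrite // inE /= /cycle_adj eqxx orTb andbT -val_eqE.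
  by rewrite [val (ordS i)]ordSE /=; have := ltn_ord i; case: ifP; lia.
rewrite card_imset ?cardsT ?card_ord // => i j eij.
have: i \in e j by rewrite -eij set21.
have: ordS i \in e j by rewrite -eij set22.
rewrite !inE -!val_eqE ![val (ordS _)]ordSE /= => Sij ij; apply: val_inj.
by move: Sij ij; case: ifP; case: ifP; rewrite /=; lia.
Qed.

(* [low_jump] and [high_jump] are the positions of the skip of 3k+3 or k+1,
   according to which of the two occurs at a low-label or a high-label step. *)
Definition low_jump k := if odd k then k else 3 * k - 1.
Definition high_jump k := if odd k then 3 * k - 1 else k.

Definition zigzag k v :=
  if odd v then 4 * k + 3 - v./2 - 2 * (2 * k < v) - (high_jump k < v)
  else v./2 + (low_jump k < v).

(** The additive form spares later arguments the truncated subtractions of [zigzag], none of which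
    truncates for v < 4k. *)
Lemma zigzag_odd k v : v < 4 * k -> odd v ->
  zigzag k v + (v./2 + 2 * (2 * k < v) + (high_jump k < v)) = 4 * k + 3.
Proof.
move=> lt_v ov; rewrite /zigzag ov -!subnDA -[v./2 + _ + _]addnA subnK //.
by have := odd_double_half v; rewrite ov; do 2!case: (_ < v); lia.
Qed.

Lemma zigzag_even k v : ~~ odd v -> zigzag k v = v./2 + (low_jump k < v).
Proof. by rewrite /zigzag => /negbTE->. Qed.

(** Low labels are at most (2k-1)+1 = 2k, and high labels at least 4k+3-(2k-1)-3 = 2k+1. *)
Lemma zigzag_low_high k u v : u < 4 * k -> v < 4 * k ->
  ~~ odd u -> odd v -> zigzag k u < zigzag k v.
Proof.
move=> lt_u lt_v eu ov; rewrite (zigzag_even _ eu).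
have := zigzag_odd lt_v ov.
have := odd_double_half u; have := odd_double_half v; rewrite ov (negbTE eu).
move: (zigzag k v) (u./2) (v./2) => z i j.
case: (_ < u); case: (high_jump k < v); case: (_ < v); lia.
Qed.

Lemma zigzag_le k v : v < 4 * k -> zigzag k v <= 4 * k + 3.
Proof.
move=> lt_v; case: (boolP (odd v)) => [ov|ev].
  by rewrite -(zigzag_odd lt_v ov) leq_addr.
rewrite (zigzag_even _ ev); have := odd_double_half v.
by rewrite (negbTE ev); case: (_ < v); lia.
Qed.

Lemma zigzag_inj k u v : u < 4 * k -> v < 4 * k ->
  zigzag k u = zigzag k v -> u = v.
Proof.
wlog le_uv : u v / u <= v => [th lt_u lt_v euv|].
  by case/orP: (leq_total u v) => le_uv; [|apply/esym]; apply: th.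
move=> lt_u lt_v.
(* Jump indicators are monotone in the position, so low labels strictly increase and high labels
   strictly decrease. This settles positions of equal parity. *)
have mono a : (a < u) <= (a < v).
  by case: (ltnP a u) => // lt_au; rewrite (leq_trans lt_au le_uv).
have := odd_double_half u; have := odd_double_half v.
case: (boolP (odd u)) (boolP (odd v)) => [ou [ov|ev]|eu [ov|ev]].
- have := zigzag_odd lt_u ou; have := zigzag_odd lt_v ov.
  move=> + + + + euv; rewrite euv.
  have := mono (2 * k); have := mono (high_jump k).
  do 4!move: (nat_of_bool (_ < _)) => ?; move: (zigzag k v) (u./2) (v./2).
  by clear -le_uv => *; lia.
- by move=> _ _ E; have := zigzag_low_high lt_v lt_u ev ou; rewrite E ltnn.
- by move=> _ _ E; have := zigzag_low_high lt_u lt_v eu ov; rewrite E ltnn.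
- rewrite (zigzag_even _ eu) (zigzag_even _ ev).
  have := mono (low_jump k).
  do 2!move: (nat_of_bool (_ < _)) => ?; move: (u./2) (v./2).
  by clear -le_uv => *; lia.
Qed.

(* The number of values skipped before the difference of the edge from [v] to
   [v.+1]. *)
Definition skips k v := (k <= v) + 2 * (2 * k <= v) + (3 * k <= v.+1).

Lemma odd_neq_leq a v : odd a != odd v -> (a <= v) = (a < v).
Proof. by rewrite leq_eqVlt; case: (eqVneq a v) => [->|//]; rewrite eqxx. Qed.

(** The jumps sit at k and 3k-1, with [low_jump] odd and [high_jump] even in either order; parity
    then makes strict and weak thresholds agree. *)
Lemma skips_odd k v : 0 < k -> odd v ->
  (low_jump k < v.+1) + 2 * (2 * k < v) + (high_jump k < v) = skips k v.
Proof.
move=> k_gt0 ov; rewrite /low_jump /high_jump /skips.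
have -> : (2 * k <= v) = (2 * k < v) by apply: odd_neq_leq; rewrite ov oddM.
have -> : (3 * k <= v.+1) = (3 * k - 1 <= v) by rewrite leq_subLR add1n.
case: ifP => ok; rewrite ltnS.
  by rewrite (@odd_neq_leq (3 * k - 1)) // oddB ?oddM ?ok ?ov //; lia.
by rewrite (@odd_neq_leq k) ?ok ?ov // addnC [_ + 2 * _]addnC addnA.
Qed.

Lemma skips_even k v : 0 < k -> ~~ odd v ->
  (low_jump k < v) + 2 * (2 * k < v.+1) + (high_jump k < v.+1) = skips k v.
Proof.
move=> k_gt0 ev; rewrite /low_jump /high_jump /skips !ltnS.
have -> : (3 * k <= v.+1) = (3 * k - 1 <= v) by rewrite leq_subLR add1n.
case: ifP => ok.
  by rewrite (@odd_neq_leq k) // ok (negbTE ev).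
rewrite (@odd_neq_leq (3 * k - 1)); first by rewrite addnC [_ + 2 * _]addnC addnA.
by rewrite oddB ?oddM ?ok ?(negbTE ev) //; lia.
Qed.

(** The halves of v and v+1, rounded down, add up to v, and the jumps at both ends add up to
    [skips k v]. *)
Lemma zigzag_step k v : v.+1 < 4 * k ->
  `|zigzag k v - zigzag k v.+1|%N + (v + skips k v) = 4 * k + 3.
Proof.
move=> lt_v; have lt_v' := ltnW lt_v; have k_gt0 : 0 < k by lia.
have := odd_double_half v; case: (boolP (odd v)) => [ov|ev].
  have := zigzag_odd lt_v' ov; rewrite -skips_odd //.
  have := zigzag_low_high lt_v lt_v'; rewrite /= ov => /(_ isT isT).
  rewrite [zigzag k v.+1]zigzag_even /= ?ov // uphalf_half ov.
  move: (zigzag k v) (v./2) => z i.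
  do 3!move: (nat_of_bool (_ < _)) => ?.
  by clear => lt_z ez ev; rewrite distnEl ?(ltnW lt_z) //; lia.
have := @zigzag_odd k v.+1 lt_v; rewrite /= ev -skips_even // => /(_ isT).
have := zigzag_low_high lt_v' lt_v ev; rewrite /= ev => /(_ isT).
rewrite (zigzag_even _ ev) uphalf_half (negbTE ev).
move: (zigzag k v.+1) (v./2) => z i.
do 3!move: (nat_of_bool (_ < _)) => ?.
by clear => lt_z ez ev; rewrite distnEr ?(ltnW lt_z) //; lia.
Qed.

Lemma zigzag_close k : 0 < k ->
  `|zigzag k (4 * k).-1 - zigzag k 0|%N = 2 * k + 1.
Proof.
move=> k_gt0; have o : odd (4 * k).-1 by lia.
have lt_n : (4 * k).-1 < 4 * k by lia.
have := zigzag_odd lt_n o; rewrite [zigzag k 0]zigzag_even // distn0.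
(* All high-label jumps precede the last position, whose label is thus 4k+3-(2k-1)-3. *)
have -> : 2 * k < (4 * k).-1 by lia.
have -> : high_jump k < (4 * k).-1 by rewrite /high_jump; case: ifP => _; lia.
have -> : (4 * k).-1./2 = (2 * k).-1 by have := odd_double_half (4 * k).-1; lia.
by move: (zigzag k _) => z; clear -k_gt0; lia.
Qed.

Lemma skipsE k v : 0 < k ->
  skips k v = if v < k then 0 else if v < 2 * k then 1
              else if v.+1 < 3 * k then 3 else 4.
Proof.
rewrite /skips => k_gt0.
by do 3!(case: leqP => ?); rewrite //=; lia.
Qed.

(** Cutting the positions at k, 2k and 3k-1, the differences fill in turn the intervals
    [3k+4, 4k+3], [2k+3, 3k+2], [k+2, 2k] and [1, k]. *)
Lemma step_differences k n : 0 < k ->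
  (exists2 v, v.+1 < 4 * k & n + (v + skips k v) = 4 * k + 3) <->
  [/\ 1 <= n <= 4 * k + 3, n <> k + 1, n <> 2 * k + 1, n <> 2 * (k + 1)
    & n <> 3 * (k + 1)].
Proof.
move=> k_gt0; split=> [[v lt_v]|[/andP[n_gt0 n_le] n1 n2 n3 n4]].
  rewrite skipsE //; case: ltnP => [lt1|le1]; last case: ltnP => [lt2|le2];
    last case: ltnP => [lt3|le3]; by move=> def_n; split; lia.
suff [v lt_v def_n] : exists2 v, v.+1 < 4 * k & n + (v +
    if v < k then 0 else if v < 2 * k then 1
    else if v.+1 < 3 * k then 3 else 4) = 4 * k + 3.
  by exists v; rewrite ?skipsE.
(* On each interval the witness is 4k+3-n minus the constant number of skips there: 4, 3, 1 or 0. *)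
have [le4|gt4] := leqP n k.
  exists (4 * k - n.+1); first by lia.
  by rewrite !ifF; lia.
have [le3|gt3] := leqP n (2 * k).
  exists (4 * k - n); first by lia.
  by rewrite ifF 1?ifF 1?ifT; lia.
have [le2|gt2] := leqP n (3 * k + 2).
  exists (4 * k + 2 - n); first by lia.
  by rewrite ifF 1?ifT; lia.
exists (4 * k + 3 - n); first by lia.
by rewrite ifT; lia.
Qed.

Theorem theorem4p2 (k : nat) (hk : 1 <= k) :
  exists f : cycle_graph (4 * k) -> nat, graceful_alpha_labeling 4 f.
Proof.
have n_gt1 : 1 < 4 * k by lia.
exists (fun v : 'I_(4 * k) => zigzag k v); split.
  exists k; split=> //.
  - by apply: cycle_graph_size; lia.
  - by move=> u v /zigzag_inj euv; apply/val_inj/euv.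
  - by move=> v; have := zigzag_le (ltn_ord v); lia.
  move=> n; split.
    suff diffP (u v : 'I_(4 * k)) :
        (v = u.+1 :> nat) \/ (u = (4 * k).-1 :> nat) /\ (v = 0 :> nat) ->
        n = `|zigzag k u - zigzag k v|%N ->
        1 <= n <= 4 * (k + 1) - 1
        /\ ~ (exists i : nat, 1 <= i <= 4 - 1 /\ n = i * (k + 1)).
      case=> u [v [/=]]; rewrite cycle_adjE // => uv def_n.
      case/or4P: uv => [/eqP|/eqP|/andP[/eqP ? /eqP ?]|/andP[/eqP ? /eqP ?]].
      - by move=> ?; apply: (diffP u v); [left|].
      - by move=> ?; apply: (diffP v u); [left|rewrite distnC].
      - by apply: (diffP u v); [right|].
      - by apply: (diffP v u); [right|rewrite distnC].
    have lt_v := ltn_ord v; case=> [vu|[-> ->]].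
      rewrite vu in lt_v *; move=> def_n.
      have /(step_differences n hk)[n_le n1 _ n2 n3] :
          exists2 w, w.+1 < 4 * k & n + (w + skips k w) = 4 * k + 3.
        by exists (u : nat); rewrite // def_n zigzag_step.
      clear -n_le n1 n2 n3; split; first by lia.
      by case=> [[|[|[|[|i]]]]] [] //; lia.
    (* As k >= 1, the closing difference 2k+1 lies strictly between k+1 and 2(k+1). *)
    rewrite zigzag_close // => ->; clear -hk.
    by split; [lia|case=> [[|[|[|[|i]]]]] [] //; lia].
  case=> n_le n_mult.
  have ne i : 1 <= i <= 3 -> n <> i * (k + 1).
    by move=> i_le ni; apply: n_mult; exists i.
  have edge u v (lt_u : u < 4 * k) (lt_v : v < 4 * k) :
      v = u.+1 \/ (u = (4 * k).-1) /\ (v = 0) ->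
      n = `|zigzag k u - zigzag k v|%N ->
      exists x y : cycle_graph (4 * k),
        adj x y /\ n = `|zigzag k x - zigzag k y|%N.
    move=> uv def_n; exists (Ordinal lt_u), (Ordinal lt_v); split=> //=.
    rewrite cycle_adjE //=.
    by case: uv => [->|[-> ->]]; rewrite ?eqxx ?orbT.
  (* The closing edge realizes 2k+1; every other allowed difference comes from a step. *)
  have [n_close|/eqP n_step] := eqVneq n (2 * k + 1).
    apply: (edge (4 * k).-1 0); [lia|lia|by right|].
    by rewrite zigzag_close.
  have /(step_differences n hk)[v lt_v def_n] :
      [/\ 1 <= n <= 4 * k + 3, n <> k + 1, n <> 2 * k + 1, n <> 2 * (k + 1)
        & n <> 3 * (k + 1)].
    have n1 := ne 1 isT; rewrite mul1n in n1.
    by split; [lia| | |apply: ne|apply: ne].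
  apply: (edge v v.+1); [exact: ltnW|by []|by left|].
  by apply/eqP; rewrite -(eqn_add2r (v + skips k v)) def_n zigzag_step.
(* Odd positions carry the high labels; since 4k is even, the closing edge also joins opposite
   parities. *)
pose Y := [set v : 'I_(4 * k) | odd v].
exists (~: Y), Y; split; last first.
  by move=> u v; rewrite !inE; apply: zigzag_low_high.
split; first by rewrite setUC setUCr.
  by rewrite -setI_eq0 setIC setICr.
move=> u v /=; rewrite cycle_adjE // !inE.
have lt_u := ltn_ord u; have lt_v := ltn_ord v.
by case/or4P => [/eqP->|/eqP->|/andP[/eqP-> /eqP->]|/andP[/eqP-> /eqP->]]; lia.
Qed.
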